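(* Let $m\ge 1$ and $0<q<r$ be integers, let $SH(m,q,r)$ be the sunflower hypergraph of order $t=r+(m-1)q$ with kernel $X$ and petals $Y_1,\ldots,Y_m$ (where $X\cup Y_1\cup\cdots\cup Y_m=[t]$), and let $(n_1,n_2,\ldots,n_t)$ be a vector of positive integers. Then $$\rho\big(SH(m,q,r)\circ(n_1,n_2,\ldots,n_t)\big)=\left(\prod_{k\in X}n_k\right)^{\frac{r-1}{r}}\cdot\left[\sum_{l=1}^{m}\left(\prod_{k_l\in Y_l}n_{k_l}\right)^{\frac{r-1}{r-q}}\right]^{\frac{r-q}{r}}.$$
   Context: An $r$-uniform hypergraph $H$ has a finite vertex set $V(H)$ and an edge set $E(H)$ of $r$-element subsets of $V(H)$; its order is $|V(H)|$. If $V(H)=\{v_1,\ldots,v_n\}$, its adjacency tensor $\mathcal{A}(H)=(a_{i_1\cdots i_r})$ of order $r$ and dimension $n$ has $a_{i_1\cdots i_r}=\frac{1}{(r-1)!}$ if $\{v_{i_1},\ldots,v_{i_r}\}\in E(H)$ and $0$ otherwise. A number $\lambda\in\mathbb{C}$ is an eigenvalue of $\mathcal{A}(H)$ if there is $\mathbf{x}\in\mathbb{C}^n\setminus\{0\}$ with $\sum_{i_2,\ldots,i_r\in[n]}a_{ii_2\cdots i_r}x_{i_2}\cdots x_{i_r}=\lambda x_i^{r-1}$ for all $i\in[n]$. The spectral radius $\rho(H)$ is the maximum of $|\lambda|$ over all eigenvalues $\lambda$ of $\mathcal{A}(H)$. For an $r$-uniform hypergraph $G$ with $V(G)=[t]=\{1,\ldots,t\}$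 and a vector $(n_1,\ldots,n_t)$ of positive integers, the blow-up $G\circ(n_1,\ldots,n_t)$ is the $r$-uniform hypergraph whose vertex set is a disjoint union $V_1\cup\cdots\cup V_t$ with $|V_j|=n_j$, and whose edges are exactly the sets $\{u_1,\ldots,u_r\}$ with $u_1\in V_{j_1},\ldots,u_r\in V_{j_r}$ for some $\{j_1,\ldots,j_r\}\in E(G)$. For $m>0$ and $0<q<r$, the sunflower hypergraph $SH(m,q,r)$ has vertex set $X\cup Y_1\cup\cdots\cup Y_m$ (disjoint union), with $|X|=r-q$ (kernel) and $|Y_l|=q$ (petals), and edges $X\cup Y_l$ for $1\le l\le m$. Its vertices are labelled $X=\{1,\ldots,r-q\}$ and $Y_l=\{r+(l-2)q+1,\ldots,r+(l-1)q\}$ for $1\le l\le m$. *)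

(* Defs.v *)
From HB Require Import structures.
From mathcomp Require Import all_boot all_order all_algebra.
From mathcomp Require Import zify.
From mathcomp.real_closed Require Import complex.
Set Implicit Arguments.
Unset Strict Implicit.
Unset Printing Implicit Defensive.
Import Order.TTheory GRing.Theory Num.Theory.

Local Open Scope ring_scope.
Local Open Scope complex_scope.

Record hypergraph (r : nat) (V : finType) := Hypergraph {
  edges : {set {set V}};
  edges_uniform : forall e, e \in edges -> #|e| = r
}.

(* Tensors of order k whose dimension is #|V|: the indices are the elements
   of V themselves, so no numbering of V is chosen. *)
Definition tensor (K : Type) (k : nat) (V : finType) := k.-tuple V -> K.

Definition adjacency_tensor (R : rcfType) r (V : finType)
    (H : hypergraph r V) : tensor R[i] r V :=
  fun s => if [set v in s] \in edges H then ((r.-1)`!%:R)^-1 else 0.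

(* The sum ranges over the index tuples (i_1, ..., i_k) with i_1 = i. *)
Definition tensor_eigenvalue (K : fieldType) k (V : finType)
    (A : tensor K k V) (lambda : K) : Prop :=
  exists2 x : {ffun V -> K}, x != 0 &
    forall i : V,
      \sum_(s : k.-tuple V | ohead s == Some i)
        A s * \prod_(j <- behead s) x j = lambda * x i ^+ k.-1.

(* The norm on R[i] takes its values in R[i], whence the injection %:C. *)
Definition is_spectral_radius (R : rcfType) r (V : finType)
    (H : hypergraph r V) (rho : R) : Prop :=
  (exists2 lambda : R[i],
      tensor_eigenvalue (adjacency_tensor R H) lambda & `|lambda| = rho%:C) /\
  (forall lambda : R[i],
      tensor_eigenvalue (adjacency_tensor R H) lambda -> `|lambda| <= rho%:C).

Section Blowup.
Variables (r : nat) (V : finType) (G : hypergraph r V) (n : V -> nat).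

(* The class V_j of the blow-up is the set of the u with tag u = j. *)
Definition blowup_vertex : finType := {j : V & 'I_(n j)}.

Definition blowup_edges : {set {set blowup_vertex}} :=
  [set [set u in s] | s : r.-tuple blowup_vertex
                      & [set j in map tag s] \in edges G].

Lemma blowup_uniform e : e \in blowup_edges -> #|e| = r.
Proof.
case/imsetP => s; rewrite inE => sG ->.
have := edges_uniform sG; rewrite !cardsE => rE.
have sz : size (map tag s) = r by rewrite size_map size_tuple.
have /card_uniqP us : #|map tag s| = size (map tag s) by rewrite rE sz.
by move/map_uniq/card_uniqP: us => ->; rewrite size_tuple.
Qed.

Definition blowup : hypergraph r blowup_vertex := Hypergraph blowup_uniform.
End Blowup.

Section Sunflower.
Variables m q r : nat.

Definition sunflower_order : nat := (r + m.-1 * q)%N.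

(* The ordinal i stands for the label i + 1, and l : 'I_m for the petal
   number l + 1. *)
Definition sunflower_kernel : {set 'I_sunflower_order} :=
  [set i : 'I_sunflower_order | (i < r - q)%N].

Definition sunflower_petal (l : 'I_m) : {set 'I_sunflower_order} :=
  [set i : 'I_sunflower_order | (r - q + l * q <= i < r + l * q)%N].

Definition sunflower_edges : {set {set 'I_sunflower_order}} :=
  [set sunflower_kernel :|: sunflower_petal l | l : 'I_m].

Hypothesis ltqr : (q < r)%N.

Lemma sunflower_uniform e : e \in sunflower_edges -> #|e| = r.
Proof.
case/imsetP => l _ ->; have ltlm := ltn_ord l.
pose g (k : 'I_r) : nat := if (k < r - q)%N then k : nat else (k + l * q)%N.
have gP k : (g k < r + m.-1 * q)%N.
  by have := ltn_ord k; rewrite /g; case: ifP; nia.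
pose f k : 'I_sunflower_order := Ordinal (gP k).
have fI : injective f.
  move=> j k /(congr1 val) /= E; apply: val_inj => /=.
  by move: E; rewrite /g; case: ifP; case: ifP; lia.
rewrite -[RHS](card_ord r) -cardsT -(card_imset _ fI); apply: eq_card => i.
apply/idP/imsetP => [|[k _ ->]].
  rewrite !inE => iP.
  have kP : ((if (i < r - q)%N then i : nat else (i - l * q)%N) < r)%N.
    by move: iP; case: ifP; lia.
  exists (Ordinal kP) => //; apply: val_inj; rewrite /= /g /= {kP}.
  case: (ltnP i (r - q)) iP => [h _ | h iP]; first by rewrite h.
  by case: ifP; lia.
by rewrite !inE /= /g; have := ltn_ord k; case: ifP; lia.
Qed.

Definition sunflower : hypergraph r 'I_sunflower_order :=
  Hypergraph sunflower_uniform.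
End Sunflower.

Arguments sunflower_kernel : clear implicits.
Arguments sunflower_petal : clear implicits.
Arguments sunflower m {q r} ltqr.

(* Main.v *)
Require Import Defs.
From mathcomp Require Import all_boot all_order all_algebra.
From mathcomp Require Import all_classical all_reals all_analysis.
From mathcomp Require Import zify ring lra.
From mathcomp.real_closed Require Import complex.
Import Order.TTheory GRing.Theory Num.Theory.
Local Open Scope ring_scope.

(** By Perron's argument, an eigenvalue of a nonnegative tensor with an
    everywhere positive eigenvector bounds the modulus of every eigenvalue, so it
    suffices to exhibit one.  On a vector equal to [y j] on the class [V_j], the
    eigenvalue equation of the blow-up, multiplied by [n_j y_j], reads
      [rho n_j y_j^r = sum over the edges e of G containing j of prod_(i in e) n_i y_i].
    For the sunflower it is solved by giving the edge [X :|: Y_l] the weight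
    [w_l], proportional to [(prod_(k in Y_l) n_k)^((r-1)/(r-q))] with total weight
    1, and choosing [n_j y_j^r] as the total weight of the edges containing [j]. *)

(** * Sums over tuples and over edges *)

(** Taking [F] on sequences rather than on tuples lets the same summand be used at every length. *)
Lemma sum_tuple_head (S : nmodType) (T : finType) k (i : T) (F : seq T -> S) :
  \sum_(s : k.+1.-tuple T | ohead s == Some i) F s =
  \sum_(s : k.-tuple T) F (i :: s).
Proof.
rewrite (reindex_onto (fun s : k.-tuple T => [tuple of i :: s])
  (fun s => [tuple of behead s])) /=; last first.
  by move=> s; case/tupleP: s => x s /= /eqP[->]; apply: val_inj.
by apply: eq_bigl => s; rewrite eqxx; apply/eqP/val_inj.
Qed.

Lemma sum_tuple_cons (S : nmodType) (T : finType) k (F : seq T -> S) :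
  \sum_(s : k.+1.-tuple T) F s =
  \sum_(i : T) \sum_(s : k.-tuple T) F (i :: s).
Proof.
rewrite (partition_big (fun s : k.+1.-tuple T => thead s) xpredT) //=.
apply: eq_bigr => i _; rewrite -sum_tuple_head; apply: eq_bigl => s.
by case/tupleP: s => x s; rewrite theadE.
Qed.

(** Each entry [v] of a tuple of classes can be lifted to any of [n v] vertices, independently of
    the other entries. *)
Lemma sum_tuple_tag (S : comPzSemiRingType) (V : finType) (n : V -> nat) k
    (F : seq V -> S) :
  \sum_(s : k.-tuple {j : V & 'I_(n j)}) F (map tag s) =
  \sum_(t : k.-tuple V) F t * \prod_(v <- t) (n v)%:R.
Proof.
elim: k F => [|k IHk] F.
  have sum0 (T : finType) (f : seq T -> S) :
      \sum_(s : 0.-tuple T) f s = f [::].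
    rewrite (eq_bigr (fun=> f [::])); last by move=> s _; rewrite tuple0.
    by rewrite big_const card_tuple expn0 /= addr0.
  rewrite (sum0 _ (fun s => F (map tag s))).
  by rewrite (sum0 _ (fun t => F t * \prod_(v <- t) (n v)%:R)) big_nil mulr1.
rewrite (@sum_tuple_cons S _ k (fun s => F (map tag s))).
rewrite (@sum_tuple_cons S _ k (fun t => F t * \prod_(v <- t) (n v)%:R)).
transitivity (\sum_(j : V) \sum_(a : 'I_(n j))
    \sum_(t : k.-tuple V) F (j :: t) * \prod_(v <- t) (n v)%:R).
  rewrite [RHS]sig_big_dep /=; apply: eq_bigr => -[j a] _ /=.
  exact: (IHk (fun t => F (j :: t))).
apply: eq_bigr => j _; rewrite sumr_const card_ord -mulr_natl mulr_sumr.
by apply: eq_bigr => t _; rewrite big_cons mulrCA.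
Qed.

(** Such tuples are exactly the orderings of [e :\ j]: since [e] has [k.+1] elements, no entry can
    repeat or equal [j]. *)
Lemma card_tuple_edge (T : finType) k (j : T) (e : {set T}) :
  #|e| = k.+1 -> j \in e ->
  #|[set s : k.-tuple T | [set v in j :: s] == e]| = k`!.
Proof.
move=> ek je.
rewrite -ffactnn -[X in (X ^_ _)%N](_ : #|e :\ j| = k); last first.
  by move: (cardsD1 j e); rewrite ek je add1n => -[].
rewrite -(card_uniq_tuples k (mem (e :\ j))); apply: eq_card => s; rewrite !inE.
apply/eqP/andP => [E|[/allP se us]].
  have us : uniq (j :: s).
    by apply/card_uniqP; rewrite -cardsE E ek /= size_tuple.
  move: us => /= /andP[js us]; split => //; apply/allP => v vs.
  rewrite !inE -E !inE vs orbT andbT; apply: contraNneq js => <-; exact: vs.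
apply/eqP; rewrite eqEcard; apply/andP; split.
  apply/fintype.subsetP => v; rewrite !inE => /predU1P[-> //|vs].
  by have := se v vs; rewrite !inE => /andP[].
rewrite ek cardsE; have /card_uniqP -> : uniq (j :: s) => /=.
  by rewrite us andbT; apply/negP => /se; rewrite !inE eqxx.
by rewrite size_tuple.
Qed.

(** Grouping tuples by their underlying edge, the count of orderings cancels the normalisation of
    the adjacency tensor. *)
Lemma sum_tuple_edges (K : numFieldType) k (T : finType)
    (H : hypergraph k.+1 T) (j : T) (z : T -> K) :
  \sum_(s : k.-tuple T)
    (if [set v in j :: s] \in edges H then (k`!%:R)^-1 else 0)
    * \prod_(v <- j :: s) z v =
  \sum_(e in edges H | j \in e) \prod_(v in e) z v.
Proof.
transitivity (\sum_(s : k.-tuple T | [set v in j :: s] \in edges H)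
    (k`!%:R)^-1 * \prod_(v <- j :: s) z v).
  rewrite [RHS]big_mkcond; apply: eq_bigr => s _.
  by case: ifP => // _; rewrite mul0r.
rewrite (partition_big (fun s : k.-tuple T => [set v in j :: s])
  (fun e => (e \in edges H) && (j \in e))) /=; last first.
  by move=> s ->; rewrite !inE eqxx.
apply: eq_bigr => e /andP[eH je]; have ek := edges_uniform eH.
transitivity (\sum_(s in [set s : k.-tuple T | [set v in j :: s] == e])
   (k`!%:R)^-1 * \prod_(v in e) z v).
  apply: eq_big => [s|s /andP[_ /eqP E]].
    by rewrite inE; case: eqP => [->|]; rewrite ?eH ?andbF.
  congr (_ * _); rewrite [LHS]big_uniq.
    by apply: eq_bigl => v; rewrite -E inE.
  by apply/card_uniqP; rewrite -cardsE E ek /= size_tuple.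
by rewrite sumr_const card_tuple_edge // -mulrnAl -mulr_natl mulfV ?mul1r //.
Qed.

(** * The eigenvalue equation of a blow-up *)

(** An edge of the blow-up may come from another tuple [s'] than [s], but the set of tags depends
    only on the set of entries. *)
Lemma mem_blowup_edges r (V : finType) (G : hypergraph r V) (n : V -> nat)
    (s : r.-tuple (blowup_vertex n)) :
  ([set u in s] \in edges (blowup G n)) = ([set j in map tag s] \in edges G).
Proof.
apply/idP/idP => [/imsetP[s' + E]|sG]; last first.
  by apply/imsetP; exists s; rewrite ?inE.
rewrite inE; suff -> : [set j in map tag s'] = [set j in map tag s] by [].
apply/finset.setP => j; rewrite !inE.
have ss' u : (u \in s') = (u \in s) by move/finset.setP/(_ u): E; rewrite !inE.
by apply/mapP/mapP => -[u us ->]; exists u; rewrite ?ss' // -ss'.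
Qed.

(** The vertex [u] is fixed in the sum, so its class contributes no factor; multiplying by [n_j y_j]
    for [j = tag u] supplies it and makes each edge product symmetric. *)
Lemma blowup_tensor_sum (R : rcfType) r (V : finType) (G : hypergraph r V)
    (n : V -> nat) (y : V -> R[i]) (u : blowup_vertex n) :
  (0 < r)%N ->
  (\sum_(s : r.-tuple (blowup_vertex n) | ohead s == Some u)
     adjacency_tensor R (blowup G n) s * \prod_(w <- behead s) y (tag w))
  * ((n (tag u))%:R * y (tag u)) =
  \sum_(e in edges G | tag u \in e) \prod_(j in e) ((n j)%:R * y j).
Proof.
case: r G => // k G _; rewrite mulr_suml.
pose c (t : seq V) : R[i] :=
  if [set j in t] \in edges G then (k`!%:R)^-1 else 0.
transitivity (\sum_(s : k.+1.-tuple (blowup_vertex n) | ohead s == Some u)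
   c (map tag s) * \prod_(w <- behead s) y (tag w)
   * ((n (tag u))%:R * y (tag u))).
  by apply: eq_bigr => s _; rewrite /adjacency_tensor mem_blowup_edges.
rewrite (@sum_tuple_head _ _ k u (fun s => c (map tag s)
  * \prod_(w <- behead s) y (tag w) * ((n (tag u))%:R * y (tag u)))) /=.
under eq_bigr do rewrite -(big_map tag xpredT y).
rewrite (@sum_tuple_tag _ _ n k (fun t => c (tag u :: t) * \prod_(v <- t) y v
  * ((n (tag u))%:R * y (tag u)))).
rewrite -sum_tuple_edges; apply: eq_bigr => t _.
rewrite big_cons big_split /= -!mulrA; congr (_ * _).
by rewrite [LHS]mulrC -!mulrA.
Qed.

(** * Perron's bound *)

(* Compare both sides at an index maximizing [`|x i| / y i]. *)
Lemma perron_bound (K : numFieldType) k (V : finType) (A : tensor K k V)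
    (y : V -> K) (rho lambda : K) :
  (forall s, 0 <= A s) -> (forall i, 0 < y i) ->
  (forall i, \sum_(s : k.-tuple V | ohead s == Some i)
     A s * \prod_(j <- behead s) y j <= rho * y i ^+ k.-1) ->
  tensor_eigenvalue A lambda -> `|lambda| <= rho.
Proof.
move=> A0 y0 Ay [x x0 Ax].
have [i0 xi0] : exists i, x i != 0.
  apply/existsP; apply: contraNT x0; rewrite negb_exists => /forallP h.
  by apply/eqP/ffunP => i; rewrite ffunE; apply/eqP; move: (h i); rewrite negbK.
pose f i := `|x i| / y i.
have f0 i : 0 <= f i by rewrite divr_ge0 // ltW.
(* The order on [K] is only partial; a maximum exists because the ratios are nonnegative, hence
   real. *)
have [] := @real_arg_maxP _ _ i0 xpredT f isT.
  by move=> i _; apply: ger0_real.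
move=> i _ imax; set c := f i in imax.
have xle j : `|x j| <= c * y j by rewrite -ler_pdivrMr //; apply: imax.
have xiE : `|x i| = c * y i by rewrite /c /f divfK // gt_eqF.
have c0 : 0 < c.
  apply: lt_le_trans (imax i0 isT); rewrite divr_gt0 // normr_gt0 //.
have cy : 0 < (c * y i) ^+ k.-1 by rewrite exprn_gt0 // mulr_gt0.
(* Scaling by [(c * y i) ^+ k.-1], the power of [|x i|], turns the left side into the modulus of the
   tensor sum at [i]. *)
rewrite -(ler_pM2r cy) -{1}xiE -normrX -normrM -Ax.
apply: le_trans (ler_norm_sum _ _ _) _.
rewrite exprMn mulrCA.
apply: le_trans (_ : _ <= c ^+ k.-1 * (\sum_(s : k.-tuple V | ohead s == Some i)
     A s * \prod_(j <- behead s) y j)) _; last first.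
  by rewrite ler_pM2l ?Ay // exprn_gt0.
rewrite mulr_sumr; apply: ler_sum => s _.
rewrite normrM (ger0_norm (A0 s)) mulrCA; apply: ler_wpM2l => //.
have <- : size (behead s) = k.-1 by rewrite size_behead size_tuple.
rewrite normr_prod.
elim: (behead s) => [|j t IHt]; first by rewrite !big_nil mulr1.
rewrite !big_cons /= exprS mulrACA; apply: ler_pM => //.
by apply: prodr_ge0.
Qed.

Lemma powR_prod (R : realType) (I : finType) (A : {pred I}) (F : I -> R) (p : R) :
  (forall i, 0 <= F i) ->
  (\prod_(i in A) F i) `^ p = \prod_(i in A) F i `^ p.
Proof.
move=> F0; pose K (x y : R) := 0 <= x /\ x `^ p = y.
suff [] : K (\prod_(i in A) F i) (\prod_(i in A) F i `^ p) by [].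
apply: (big_ind2 K) => [|x1 x2 y1 y2 [x0 <-] [y0 <-]|i _]; split => //.
- by rewrite powR1.
- exact: mulr_ge0.
- by rewrite powRM.
Qed.

(** * Combinatorics of the sunflower *)

Lemma card_sunflower_kernel (m q r : nat) : #|sunflower_kernel m q r| = (r - q)%N.
Proof.
rewrite -sum1_card -[RHS]card_ord -[RHS]sum1_card.
rewrite (@big_ord_widen _ _ _ _ (sunflower_order m q r) (fun=> 1%N)); last first.
  exact: leq_trans (leq_subr q r) (leq_addr _ _).
by apply: eq_bigl => i; rewrite inE.
Qed.

Lemma disjoint_kernel_petal (m q r : nat) (l : 'I_m) :
  [disjoint sunflower_kernel m q r & sunflower_petal m q r l].
Proof. by apply/pred0P => i /=; rewrite !inE; lia. Qed.

Lemma card_sunflower_petal (m q r : nat) (l : 'I_m) :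
  (q < r)%N -> #|sunflower_petal m q r l| = q.
Proof.
move=> hqr; have eE : sunflower_kernel m q r :|: sunflower_petal m q r l
    \in edges (sunflower m hqr) by apply: imset_f.
have := edges_uniform eE; rewrite cardsU card_sunflower_kernel.
have /disjoint_setI0 -> := disjoint_kernel_petal m q r l.
by rewrite cards0; lia.
Qed.

Lemma sunflower_petal_inj (m q r : nat) (l l' : 'I_m) i :
  (0 < q)%N ->
  i \in sunflower_petal m q r l -> i \in sunflower_petal m q r l' -> l = l'.
Proof. by rewrite !inE => hq h h'; apply: val_inj => /=; nia. Qed.

(** A petal is nonempty and misses the kernel, so any of its elements identifies the edge. Sums over
    edges thus become sums over [l]. *)
Lemma sunflower_edge_inj (m q r : nat) :
  (0 < q)%N -> (q < r)%N ->
  injective (fun l => sunflower_kernel m q r :|: sunflower_petal m q r l).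
Proof.
move=> hq hqr l l' E.
have /card_gt0P[i il] : (0 < #|sunflower_petal m q r l|)%N.
  by rewrite card_sunflower_petal.
apply: (sunflower_petal_inj m q r l l' i hq il); move/finset.setP/(_ i): E.
have iK : i \notin sunflower_kernel m q r.
  by rewrite (disjointFl (disjoint_kernel_petal m q r l) il).
by rewrite !finset.in_setU il orbT (negbTE iK) orFb => <-.
Qed.

Lemma sunflower_cover (m q r : nat) (i : 'I_(sunflower_order m q r)) :
  (0 < m)%N -> (0 < q)%N -> (q < r)%N ->
  exists l, i \in sunflower_kernel m q r :|: sunflower_petal m q r l.
Proof.
move=> hm hq hqr; have im := ltn_ord i; rewrite [X in (_ < X)%N]/sunflower_order in im.
case: (ltnP i (r - q)) => h; first by exists (Ordinal hm); rewrite !inE h.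
(* Beyond the kernel, the labels form consecutive blocks of length [q], so the quotient is the petal
   index. *)
have lm : ((i - (r - q)) %/ q < m)%N.
  by rewrite ltn_divLR //; nia.
exists (Ordinal lm); rewrite !inE /=.
have := divn_eq (i - (r - q)) q; have := ltn_pmod (i - (r - q)) hq; lia.
Qed.

(** * Edge weights and the positive eigenvector *)

(** With [P] and [Q] the products of the [n_k] over kernel and petal, the left side is the product
    of the [n_i y_i] over an edge of weight [w], and the right side is [rho * w]. The exponent in
    [w] is the one making [w] to the power [(r - q) / r] proportional to [Q] to the power
    [(r - 1) / r]. *)
Lemma sunflower_powR_identity (R : realType) (P Q A q r : R) :
  0 < P -> 0 < Q -> 0 < A -> 0 < q -> q < r ->
  let w := Q `^ ((r - 1) / (r - q)) / A in
  P `^ ((r - 1) / r) * (Q `^ ((r - 1) / r) * w `^ (q / r)) =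
  P `^ ((r - 1) / r) * A `^ ((r - q) / r) * w.
Proof.
move=> P0 Q0 A0 q0 qr w.
have r0 : r != 0 by lra.
have w0 : 0 < w by rewrite divr_gt0 // powR_gt0.
have Aw : A * w = Q `^ ((r - 1) / (r - q)) by rewrite /w mulrC divfK ?gt_eqF.
(* Splitting w as w^((r-q)/r) w^(q/r) lets A and w recombine into A w. *)
have {2}-> : w = w `^ ((r - q) / r) * w `^ (q / r).
  rewrite -powRD; last by rewrite (gt_eqF w0) implybT.
  by rewrite -mulrDl subrK divff // powRr1 // ltW.
rewrite -!mulrA; congr (_ * _); rewrite mulrA; congr (_ * _).
rewrite -powRM ?ltW // Aw -powRrM; congr (_ `^ _).
by field; apply/andP; split; lra.
Qed.

Lemma sunflower_eigenvector (R : realType) (m q r : nat)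
    (hm : (1 <= m)%N) (hq : (0 < q)%N) (hqr : (q < r)%N)
    (n : 'I_(sunflower_order m q r) -> nat) (hn : forall j, (0 < n j)%N) :
  exists2 y : 'I_(sunflower_order m q r) -> R, (forall j, 0 < y j) &
    forall j, \sum_(e in edges (sunflower m hqr) | j \in e)
                \prod_(i in e) ((n i)%:R * y i) =
    ((\prod_(k in sunflower_kernel m q r) (n k)%:R : R) `^ ((r%:R - 1) / r%:R) *
     (\sum_(l < m) (\prod_(k in sunflower_petal m q r l) (n k)%:R)
                     `^ ((r%:R - 1) / (r%:R - q%:R)))
       `^ ((r%:R - q%:R) / r%:R)) * ((n j)%:R * y j ^+ r).
Proof.
set P := \prod_(k in _) _.
pose Q (l : 'I_m) : R := \prod_(k in sunflower_petal m q r l) (n k)%:R.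
set A := \sum_(l < m) _; set rho := P `^ _ * _.
have n0 j : 0 < (n j)%:R :> R by rewrite ltr0n.
have P0 : 0 < P by apply: prodr_gt0.
have Q0 l : 0 < Q l by apply: prodr_gt0.
have A0 : 0 < A.
  rewrite /A (bigD1 (Ordinal hm)) //= ltr_pwDl ?powR_gt0 //; first exact: Q0.
  by apply: sumr_ge0 => l _; apply: powR_ge0.
have r0 : r%:R != 0 :> R by rewrite pnatr_eq0; lia.
pose w l := Q l `^ ((r%:R - 1) / (r%:R - q%:R)) / A.
have w0 l : 0 < w l by rewrite divr_gt0 ?powR_gt0.
have wsum : \sum_l w l = 1 by rewrite -mulr_suml divff ?gt_eqF.
pose E l := sunflower_kernel m q r :|: sunflower_petal m q r l.
(* The total weight at [j]: it is 1 on the kernel, which lies in all edges, and [w l] on petal [l],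
   which lies in one. *)
pose c j := \sum_(l | j \in E l) w l.
have c0 j : 0 < c j.
  have [l jl] := sunflower_cover m q r j hm hq hqr.
  rewrite /c (bigD1 l) //= ltr_pwDl //.
  by apply: sumr_ge0 => l' _; apply: ltW.
have cK j : j \in sunflower_kernel m q r -> c j = 1.
  by move=> jK; rewrite -wsum; apply: eq_bigl => l; rewrite finset.in_setU jK.
have cY j l : j \in sunflower_petal m q r l -> c j = w l.
  move=> jl; rewrite /c (big_pred1 l) // => l'.
  rewrite finset.in_setU (disjointFl (disjoint_kernel_petal m q r l) jl) /=.
  apply/idP/eqP => [jl'|-> //]; exact: (sunflower_petal_inj m q r l' l j hq jl' jl).
pose y j := (c j / (n j)%:R) `^ r%:R^-1.
have yr j : (n j)%:R * y j ^+ r = c j.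
  rewrite /y -powR_mulrn ?powR_ge0 // -powRrM mulVf // powRr1.
    by rewrite mulrC divfK // gt_eqF.
  by rewrite ltW // divr_gt0.
have ny j : (n j)%:R * y j = (n j)%:R `^ ((r%:R - 1) / r%:R) * c j `^ r%:R^-1.
  rewrite /y powRM ?invr_ge0 ?ltW // mulrCA mulrC; congr (_ * _).
  rewrite -[X in X * _]powRr1 ?ltW // -powR_inv1 ?ltW // -powRrM -powRD.
    by congr (_ `^ _); field.
  by rewrite (gt_eqF (n0 j)) implybT.
exists y => [j|j]; first by rewrite powR_gt0 // divr_gt0.
(* The right side is now the sum of [rho * w l] over the edges through [j], so it suffices to match
   the two sides edge by edge. *)
rewrite yr /c mulr_sumr.
transitivity (\sum_(l | j \in E l) \prod_(i in E l) ((n i)%:R * y i)).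
  rewrite big_mkcondr big_imset /=; last first.
    by move=> l l' _ _; apply: sunflower_edge_inj.
  by rewrite -big_mkcondr.
apply: eq_bigr => l _.
rewrite -[RHS](@sunflower_powR_identity _ P (Q l) A q%:R r%:R) ?ltr0n ?ltr_nat //.
rewrite (eq_bigl [predU sunflower_kernel m q r & sunflower_petal m q r l]); last first.
  by move=> i; rewrite !inE.
rewrite bigU ?disjoint_kernel_petal //=.
congr (_ * _).
  rewrite powR_prod; last by move=> i; apply: ltW.
  by apply: eq_bigr => i iK; rewrite ny cK // powR1 mulr1.
rewrite powR_prod; last by move=> i; apply: ltW.
under eq_bigr => i il do rewrite ny (cY _ _ il).
rewrite big_split /= prodr_const card_sunflower_petal //; congr (_ * _).
by rewrite -powR_mulrn ?powR_ge0 // -powRrM mulrC.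
Qed.

(** * The spectral radius *)

Theorem theorem4p2 (R : realType) (m q r : nat)
    (hm : (1 <= m)%N) (hq : (0 < q)%N) (hqr : (q < r)%N)
    (n : 'I_(sunflower_order m q r) -> nat) (hn : forall j, (0 < n j)%N) :
  is_spectral_radius (blowup (sunflower m hqr) n)
    ((\prod_(k in sunflower_kernel m q r) (n k)%:R : R) `^ ((r%:R - 1) / r%:R) *
     (\sum_(l < m) (\prod_(k in sunflower_petal m q r l) (n k)%:R)
                     `^ ((r%:R - 1) / (r%:R - q%:R)))
       `^ ((r%:R - q%:R) / r%:R)).
Proof.
have [y y0] := @sunflower_eigenvector R m q r hm hq hqr n hn.
set rho := (_ `^ _ * _) => yE.
have rho0 : 0 <= rho by rewrite mulr_ge0 ?powR_ge0.
have r0 : (0 < r)%N by lia.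
pose yC j := (y j)%:C%C.
have yC0 j : 0 < yC j by rewrite ltcR.
have eqy (u : blowup_vertex n) :
    \sum_(s : r.-tuple (blowup_vertex n) | ohead s == Some u)
      adjacency_tensor R (blowup (sunflower m hqr) n) s
      * \prod_(v <- behead s) yC (tag v) = rho%:C%C * yC (tag u) ^+ r.-1.
  have nyu : (n (tag u))%:R * yC (tag u) != 0.
    by rewrite mulf_neq0 ?pnatr_eq0 -?lt0n ?gt_eqF.
  (* Multiplying by the nonzero [n_j y_j] reduces the equation to the real one solved by [y]. *)
  apply: (mulIf nyu); rewrite blowup_tensor_sum //.
  have -> : rho%:C%C * yC (tag u) ^+ r.-1 * ((n (tag u))%:R * yC (tag u)) =
            (rho * ((n (tag u))%:R * y (tag u) ^+ r))%:C%C.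
    rewrite -mulrA [_ ^+ _ * _]mulrCA -exprSr prednK //.
    by rewrite !rmorphM rmorphXn rmorph_nat.
  rewrite -yE rmorph_sum; apply: eq_bigr => e _.
  rewrite rmorph_prod; apply: eq_bigr => i _.
  by rewrite rmorphM rmorph_nat.
split.
  exists rho%:C%C; last by rewrite ger0_norm // lecR.
  have i0 : 'I_(sunflower_order m q r).
    by apply: (@Ordinal _ 0); rewrite /sunflower_order; lia.
  exists [ffun u => yC (tag u)].
    (* The vector is nonzero because the blow-up has a vertex: the class of [i0] is nonempty by
       [hn]. *)
    apply/eqP => /ffunP /(_ (Tagged (fun j => 'I_(n j)) (Ordinal (hn i0)))).
    by rewrite !ffunE /= => /eqP; rewrite gt_eqF.
  move=> u; rewrite ffunE -eqy; apply: eq_bigr => s _; congr (_ * _).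
  by apply: eq_bigr => v _; rewrite ffunE.
move=> lambda; apply: (@perron_bound _ _ _ _ (fun u => yC (tag u))) => [s|u|u] //.
  by rewrite /adjacency_tensor; case: ifP; rewrite // invr_ge0.
by rewrite eqy.
Qed.
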